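(* Let $\mathbb K$ be a computable age, and let $\mathrm{AB}$ be the collection of all embeddings between elements of $\mathbb K$ whose codomain is some amalgamation base in $\mathbb K$. Let $\mathscr{EI}(\mathbb K)''$ denote the double Turing jump of the embedding information $\mathscr{EI}(\mathbb K)$. Then (a) the Turing degree of $\mathrm{AB}$ is $\leq_{\mathrm T}\mathscr{EI}(\mathbb K)''$, and (b) when $\mathbb K$ has the cofinal amalgamation property (CAP), it has the $\mathscr{EI}(\mathbb K)''$-computable cofinal amalgamation property $\mathscr{EI}(\mathbb K)''$-(cCAP).
   Context: Languages and structures. $\mathcal{L}$ is a countable language (relation symbols of positive arity; function symbols of any arity, 0-ary ones being constants) with a computable representation: relation symbols $R_n$ and function symbols $F_m$ are indexed bijectively by disjoint computable subsets of $\omega$, with arity computable from the index. An $\mathcal{L}$-structure $\mathcal{M}$ is c.e. if its underlying set $M$ is a c.e. subset of $\omega$ and the sets $\{(n,\mathbf a): \mathcal M\models R_n(\mathbf a)\}$, $\{(n,\mathbf a): \mathcal M\models \neg R_n(\mathbf a)\}$, $\{(m,\mathbf a,b): \mathcal M\models F_m(\mathbf a)=b\}$ are c.e.; it is computable if moreover $M$ is computable. Tuples are finite; $\mathrm{cl}_{\mathcal M}(\mathbf a)$ is the smallest substructure of $\mathcal M$ containing $\mathbf a$. For $\mathbf a\in\mathcal A$, $\mathbf b\in\mathcal B$ of the same length, $\mathbf a\simeq\mathbf b$ means that for every atomic $\mathcal L$-formula $\varphi$, $\mathcal A\models\varphi(\mathbf a)$ iff $\mathcal B\models\varphi(\mathbf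 b)$; equivalently $\mathbf a\mapsto\mathbf b$ extends to an isomorphism $\mathrm{cl}(\mathbf a)\to\mathrm{cl}(\mathbf b)$. Ages. An age is a collection of finitely generated $\mathcal L$-structures closed under isomorphism. A computable age (computable representation of an age $\mathcal K$) is a c.e. set $\mathbb K$ of triples $(\mathbf a,\mathcal A,i)$ (computable structures being given by indices), with exactly one triple for each $i\in\omega$, written $\mathbb I(i)=(\mathbf a_i,\mathcal A_i,i)$, such that each $\mathcal A_i$ is a computable $\mathcal L$-structure in $\mathcal K$ with $\mathcal A_i=\mathrm{cl}_{\mathcal A_i}(\mathbf a_i)$, and every $\mathcal B\in\mathcal K$ is isomorphic to some $\mathcal A_i$. $\mathbb K$ is said to have a property of ages if $\mathcal K$ does. The embedding information $\mathscr{EI}(\mathbb K)$ is the set of tuples $(\mathbb I(k_0),\mathbf b_0,\mathbb I(k_1),\mathbf b_1)$ with $\mathbf b_0\in\mathcal A_{k_0}$, $\mathbf b_1\in\mathcal A_{k_1}$ and $\mathbf b_0\simeq\mathbf b_1$. Embeddings and amalgamation diagrams. A potential embedding in $\mathbb K$ is a triple $F=(\mathbb I(i),\mathbb I(j),\mathbf c)$ with $\mathbf c\in\mathcal A_j$; $\mathrm{dom}(F)=\mathbb I(i)$, $\mathrm{codom}(F)=\mathbb I(j)$, $\mathrm{range}(F)=\mathbf c$. It is an embedding if $\mathbf a_i\simeq\mathbf c$ (it then encodes the embedding $\mathcal A_i\to\mathcal A_j$ sending $\mathbf a_i$ to $\mathbf c$); composition of embeddings is composition of the encoded maps, and an isomorphism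 is an embedding whose encoded map is onto. A potential span is a pair $(F_0,F_1)$ of potential embeddings with $\mathrm{dom}(F_0)=\mathrm{dom}(F_1)$; it is a span if both are embeddings. An amalgamation diagram over a potential span $(F_0,F_1)$ is a pair $(G_0,G_1)$ with $G_0$ an embedding, $G_1$ a potential embedding, $\mathrm{dom}(G_i)=\mathrm{codom}(F_i)$ for $i\in\{0,1\}$, $\mathrm{codom}(G_0)=\mathrm{codom}(G_1)$, and such that if $(F_0,F_1)$ is a span then $G_1$ is an embedding and $G_0\circ F_0=G_1\circ F_1$. Cofinal amalgamation. An amalgamation base is an $\mathcal A'\in\mathcal K$ such that whenever $\mathcal B,\mathcal C\in\mathcal K$ and $f_{\mathcal B}:\mathcal A'\to\mathcal B$, $f_{\mathcal C}:\mathcal A'\to\mathcal C$ are embeddings, there are $\mathcal D\in\mathcal K$ and embeddings $\alpha_{\mathcal B}:\mathcal B\to\mathcal D$, $\alpha_{\mathcal C}:\mathcal C\to\mathcal D$ with $\alpha_{\mathcal B}\circ f_{\mathcal B}=\alpha_{\mathcal C}\circ f_{\mathcal C}$. (CAP): every $\mathcal A\in\mathcal K$ embeds into some amalgamation base in $\mathcal K$. A collection of distinguished extensions is a collection of embeddings in $\mathbb K$ closed under pre- and post-composition with isomorphisms between elements of $\mathbb K$ and such that every $\mathbb I(i)$ is the domain of some member. A witness to (CAP) is a pair $(\mathrm{AB}_0,f)$ where $\mathrm{AB}_0$ is a collection of distinguished extensions each of whose members has an amalgamation base as codomain, and $f$ takes each tuple $(F,G_0,G_1)$ with $F\in\mathrm{AB}_0$,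 $(G_0,G_1)$ a potential span and $\mathrm{dom}(G_0)=\mathrm{dom}(G_1)=\mathrm{codom}(F)$ to an amalgamation diagram over $(G_0,G_1)$. For a Turing degree $\mathfrak s$, it is $\mathfrak s$-computable if $\mathrm{AB}_0$ is $\mathfrak s$-c.e. and $f$ is an $\mathfrak s$-computable partial function. $\mathbb K$ has $\mathfrak s$-(cCAP) if it has an $\mathfrak s$-computable witness to (CAP). *)

(* Defs.v *)
From mathcomp Require Import all_boot.
From Stdlib Require Cantor List.

Set Implicit Arguments.
Unset Strict Implicit.
Unset Printing Implicit Defensive.

(** * Relative computability on the natural numbers *)

(* Cantor's bijection nat * nat -> nat and its inverse. *)
Definition pair_code (x y : nat) : nat := Cantor.to_nat (x, y).
Definition unpairl (n : nat) : nat := (Cantor.of_nat n).1.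
Definition unpairr (n : nat) : nat := (Cantor.of_nat n).2.

Notation "⟨ x , .. , y , z ⟩" := (pair_code x .. (pair_code y z) ..)
  (at level 0, x at level 99, y at level 99, z at level 99).

(* A bijection seq nat -> nat. *)
Fixpoint seq_code (s : seq nat) : nat :=
  if s is x :: s' then (pair_code x (seq_code s')).+1 else 0.

(* Programs for the unary partial functions that are partial recursive in an
   oracle; several arguments are passed through the pairing function. *)
Inductive code : Type :=
| CZero | CSucc | CLeft | CRight | COracle
| CPair of code & code
| CComp of code & code
| CPrec of code & code
| CMu of code.

Fixpoint prim_rec (base step : nat -> nat -> Prop) (a n y : nat) : Prop :=
  if n is m.+1 then
    exists2 z, prim_rec base step a m z & step (pair_code a (pair_code m z)) y
  else base a y.

(* [eval S c x y]: the program c with oracle S halts on input x with output y. *)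
Fixpoint eval (S : nat -> Prop) (c : code) (x y : nat) {struct c} : Prop :=
  match c with
  | CZero => y = 0
  | CSucc => y = x.+1
  | CLeft => y = unpairl x
  | CRight => y = unpairr x
  | COracle => (S x /\ y = 1) \/ (~ S x /\ y = 0)
  | CPair c1 c2 =>
      exists y1 y2, [/\ eval S c1 x y1, eval S c2 x y2 & y = pair_code y1 y2]
  | CComp c1 c2 => exists2 z, eval S c2 x z & eval S c1 z y
  | CPrec c1 c2 => prim_rec (eval S c1) (eval S c2) (unpairl x) (unpairr x) y
  | CMu c1 =>
      eval S c1 (pair_code x y) 0 /\
      forall m, m < y -> exists k, eval S c1 (pair_code x m) k.+1
  end.

(* Goedel numbering of programs, a bijection code -> nat. *)
Fixpoint encode (c : code) : nat :=
  match c with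
  | CZero => 0 | CSucc => 1 | CLeft => 2 | CRight => 3 | COracle => 4
  | CPair c1 c2 => 5 + 4 * pair_code (encode c1) (encode c2)
  | CComp c1 c2 => 6 + 4 * pair_code (encode c1) (encode c2)
  | CPrec c1 c2 => 7 + 4 * pair_code (encode c1) (encode c2)
  | CMu c1 => 8 + 4 * encode c1
  end.

(* φ_e^S(x) = y *)
Definition phi (S : nat -> Prop) (e x y : nat) : Prop :=
  exists2 c, encode c = e & eval S c x y.

(* x ∈ W_e^S *)
Definition W (S : nat -> Prop) (e x : nat) : Prop := exists y, phi S e x y.

Definition no_oracle : nat -> Prop := fun=> False.

Definition turing_le (A S : nat -> Prop) : Prop :=
  exists c, forall x, (A x -> eval S c x 1) /\ (~ A x -> eval S c x 0).

Definition ce_in (S A : nat -> Prop) : Prop :=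
  exists e, forall x, A x <-> W S e x.

Definition jump (S : nat -> Prop) : nat -> Prop := fun e => W S e e.

Definition computable_fun (f : nat -> nat) : Prop :=
  exists c, forall x, eval no_oracle c x (f x).

Definition computable_pred (p : pred nat) : Prop :=
  computable_fun (fun x => p x : nat).

(** * Languages and structures *)

(* Symbols are identified with their indices. *)
Record language : Type := Language {
  is_rel : pred nat;
  is_fun : pred nat;
  arity : nat -> nat;
  is_rel_fun_disjoint : forall n, ~~ (is_rel n && is_fun n);
  rel_arity_gt0 : forall n, is_rel n -> 0 < arity n;
  is_rel_computable : computable_pred is_rel;
  is_fun_computable : computable_pred is_fun;
  arity_computable : computable_fun arity
}.

Definition relsym (L : language) : Type := {n : nat | is_rel L n}.
Definition funsym (L : language) : Type := {n : nat | is_fun L n}.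
Definition rar (L : language) (r : relsym L) : nat := arity L (sval r).
Definition far (L : language) (f : funsym L) : nat := arity L (sval f).

Record interpretation (L : language) (T : Type) : Type := Interpretation {
  irel : forall r : relsym L, (rar r).-tuple T -> Prop;
  ifun : forall f : funsym L, (far f).-tuple T -> T
}.

Record structure (L : language) : Type := Structure {
  carrier :> Type;
  interp : interpretation L carrier
}.

Definition rel_of (L : language) (A : structure L) (r : relsym L) :
  (rar r).-tuple A -> Prop := irel (interp A) (r := r).
Definition fun_of (L : language) (A : structure L) (f : funsym L) :
  (far f).-tuple A -> A := ifun (interp A) (f := f).

Definition is_embedding (L : language) (A B : structure L) (h : A -> B) : Prop :=
  [/\ injective h,
      forall (r : relsym L) (t : (rar r).-tuple A),
        rel_of t <-> rel_of (map_tuple h t) &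
      forall (f : funsym L) (t : (far f).-tuple A),
        h (fun_of t) = fun_of (map_tuple h t)].

Definition isomorphic (L : language) (A B : structure L) : Prop :=
  exists h : A -> B, is_embedding h /\ forall y, exists x, h x = y.

(* [cl a]: the (underlying set of the) smallest substructure containing a. *)
Definition closed_under_funs (L : language) (A : structure L) (P : A -> Prop) : Prop :=
  forall (f : funsym L) (t : (far f).-tuple A),
    (forall k, P (tnth t k)) -> P (fun_of t).

Definition cl (L : language) (A : structure L) (a : seq A) : A -> Prop :=
  fun x => forall P : A -> Prop,
    closed_under_funs P -> (forall y, List.In y a -> P y) -> P x.

Definition finitely_generated (L : language) (A : structure L) : Prop :=
  exists a : seq A, forall x, cl a x.

Inductive term (L : language) (n : nat) : Type :=
| Var of 'I_n
| App (f : funsym L) of ('I_(far f) -> term L n).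

Inductive atomic (L : language) (n : nat) : Type :=
| AEq of term L n & term L n
| ARel (r : relsym L) of ('I_(rar r) -> term L n).

Fixpoint teval (L : language) (A : structure L) (n : nat) (v : n.-tuple A)
    (t : term L n) : A :=
  match t with
  | Var k => tnth v k
  | App f args => fun_of [tuple teval v (args k) | k < far f]
  end.

Definition sat (L : language) (A : structure L) (n : nat) (v : n.-tuple A)
    (p : atomic L n) : Prop :=
  match p with
  | AEq s t => teval v s = teval v t
  | ARel r args => rel_of [tuple teval v (args k) | k < rar r]
  end.

(* a ≃ b *)
Definition simeq (L : language) (A B : structure L) (a : seq A) (b : seq B) : Prop :=
  exists n (u : n.-tuple A) (v : n.-tuple B),
    [/\ a = u, b = v & forall p : atomic L n, sat u p <-> sat v p].

(** * Ages *)

Record age (L : language) (K : structure L -> Prop) : Prop := Age {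
  age_fg : forall A, K A -> finitely_generated A;
  age_iso : forall A B, K A -> isomorphic A B -> K B
}.

Definition amalgamation_base (L : language) (K : structure L -> Prop)
    (A : structure L) : Prop :=
  K A /\
  forall (B C : structure L) (fB : A -> B) (fC : A -> C),
    K B -> K C -> is_embedding fB -> is_embedding fC ->
    exists (D : structure L) (gB : B -> D) (gC : C -> D),
      [/\ K D, is_embedding gB, is_embedding gC & gB \o fB =1 gC \o fC].

Definition CAP (L : language) (K : structure L -> Prop) : Prop :=
  forall A, K A ->
    exists (A' : structure L) (h : A -> A'),
      amalgamation_base K A' /\ is_embedding h.

(** * Computable structures and computable ages *)

Record omega_structure (L : language) : Type := OmegaStructure {
  univ : pred nat;
  ointerp : interpretation L {x : nat | univ x}
}.

Coercion structure_of (L : language) (M : omega_structure L) : structure L :=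
  Structure (ointerp M).

Definition elt (L : language) (M : omega_structure L) (x : M) : nat := sval x.

Definition elts_code (L : language) (M : omega_structure L) (a : seq M) : nat :=
  seq_code (map (@elt L M) a).

(* An index of a computable structure packs an index of the characteristic
   function of its universe and c.e. indices of the relations, of their
   complements and of the graphs of the functions. *)
Definition is_index (L : language) (e : nat) (M : omega_structure L) : Prop :=
  exists eU eR eN eF,
    [/\ e = ⟨eU, eR, eN, eF⟩,
        forall x, phi no_oracle eU x (univ M x : nat),
        forall x, W no_oracle eR x <->
          exists (r : relsym L) (t : (rar r).-tuple M),
            rel_of t /\ x = ⟨sval r, elts_code t⟩,
        forall x, W no_oracle eN x <->
          exists (r : relsym L) (t : (rar r).-tuple M),
            ~ rel_of t /\ x = ⟨sval r, elts_code t⟩ &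
        forall x, W no_oracle eF x <->
          exists (f : funsym L) (t : (far f).-tuple M),
            x = ⟨sval f, elts_code t, elt (fun_of t)⟩].

(* A set of triples with exactly one triple for each i is given as the family
   i |-> (gens i, index i, i). *)
Record computable_age (L : language) (K : structure L -> Prop) : Type :=
  ComputableAge {
    model : nat -> omega_structure L;
    index : nat -> nat;
    gens : forall i, seq (model i);
    index_model : forall i, is_index (index i) (model i);
    model_in_age : forall i, K (model i);
    model_generated : forall i (x : model i), cl (gens i) x;
    model_complete : forall B, K B -> exists i, isomorphic B (model i);
    triples_ce : ce_in no_oracle
      (fun n => exists i, n = ⟨elts_code (gens i), index i, i⟩)
  }.

Section ComputableAge.
Variables (L : language) (K : structure L -> Prop) (KK : computable_age K).

(* The number coding the triple 𝕀(i). *)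
Definition II (i : nat) : nat := ⟨elts_code (gens KK i), index KK i, i⟩.

Definition EI : nat -> Prop := fun n =>
  exists k0 (b0 : seq (model KK k0)) k1 (b1 : seq (model KK k1)),
    simeq b0 b1 /\ n = ⟨II k0, elts_code b0, II k1, elts_code b1⟩.

(* The potential embedding (𝕀(pdom), 𝕀(pcod), prange). *)
Record pemb : Type := PEmb {
  pdom : nat;
  pcod : nat;
  prange : seq (model KK pcod)
}.

Definition pemb_code (F : pemb) : nat :=
  ⟨II (pdom F), II (pcod F), elts_code (prange F)⟩.

Definition pemb_codes (P : pemb -> Prop) : nat -> Prop :=
  fun n => exists F, P F /\ n = pemb_code F.

Definition is_emb (F : pemb) : Prop := simeq (gens KK (pdom F)) (prange F).

Definition encodes (F : pemb) (h : model KK (pdom F) -> model KK (pcod F)) : Prop :=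
  is_embedding h /\ map h (gens KK (pdom F)) = prange F.

(* The encoded map as a relation on nat, so that maps can be composed and
   compared when the intermediate indices are only propositionally equal. *)
Definition emb_graph (F : pemb) (x y : nat) : Prop :=
  exists h, encodes (F := F) h /\ exists u, elt u = x /\ elt (h u) = y.

Definition comp_graph (G F : pemb) (x z : nat) : Prop :=
  exists y, emb_graph F x y /\ emb_graph G y z.

Definition is_iso (F : pemb) : Prop :=
  is_emb F /\ forall z : model KK (pcod F), exists x, emb_graph F x (elt z).

(* H = G ∘ F *)
Definition is_composite (G F H : pemb) : Prop :=
  [/\ [/\ is_emb F, is_emb G & is_emb H],
      pcod F = pdom G,
      pdom H = pdom F,
      pcod H = pcod G &
      forall x z, emb_graph H x z <-> comp_graph G F x z].

Definition potential_span (F0 F1 : pemb) : Prop := pdom F0 = pdom F1.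

Definition is_span (F0 F1 : pemb) : Prop :=
  [/\ potential_span F0 F1, is_emb F0 & is_emb F1].

Definition amalgamation_diagram (F0 F1 G0 G1 : pemb) : Prop :=
  [/\ is_emb G0,
      pdom G0 = pcod F0 /\ pdom G1 = pcod F1,
      pcod G0 = pcod G1 &
      is_span F0 F1 ->
        is_emb G1 /\ forall x z, comp_graph G0 F0 x z <-> comp_graph G1 F1 x z].

Record distinguished_extensions (P : pemb -> Prop) : Prop := DistinguishedExtensions {
  dist_emb : forall F, P F -> is_emb F;
  dist_precomp : forall F H C, P F -> is_iso H -> is_composite F H C -> P C;
  dist_postcomp : forall F H C, P F -> is_iso H -> is_composite H F C -> P C;
  dist_total : forall i, exists F, P F /\ pdom F = i
}.

(* Partial functions are option-valued. *)
Record CAP_witness (AB0 : pemb -> Prop)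
    (f : pemb * pemb * pemb -> option (pemb * pemb)) : Prop := CAPWitness {
  wit_dist : distinguished_extensions AB0;
  wit_base : forall F, AB0 F -> amalgamation_base K (model KK (pcod F));
  wit_fun : forall F G0 G1, AB0 F -> potential_span G0 G1 -> pdom G0 = pcod F ->
    exists H0 H1, f (F, G0, G1) = Some (H0, H1) /\ amalgamation_diagram G0 G1 H0 H1
}.

Definition CAP_fun_computable_in (S : nat -> Prop)
    (f : pemb * pemb * pemb -> option (pemb * pemb)) : Prop :=
  exists c, forall x y, eval S c x y <->
    exists F G0 G1 H0 H1,
      [/\ f (F, G0, G1) = Some (H0, H1),
          x = ⟨pemb_code F, pemb_code G0, pemb_code G1⟩ &
          y = ⟨pemb_code H0, pemb_code H1⟩].

(* S stands for its Turing degree. *)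
Definition cCAP_in (S : nat -> Prop) : Prop :=
  exists AB0 f,
    [/\ CAP_witness AB0 f,
        ce_in S (pemb_codes AB0) &
        CAP_fun_computable_in S f].

Definition AB (F : pemb) : Prop :=
  is_emb F /\ amalgamation_base K (model KK (pcod F)).

End ComputableAge.

(* Main.v *)
(* Everything reduces to queries to the embedding information. Since simeq is
   reflexive, such queries recognise the codes of triples, of tuples of a given
   model and of embeddings. If G sends the generators a of a model to d, then G
   sends c to e iff the extended tuples (a, c) and (d, e) are equivalent, so
   that "(G0, G1) amalgamates (F0, F1)" says that some tuple e passes two
   queries. Being an amalgamation base is thus of the form "for every span there
   is an amalgam", which is Pi_2 in EI and hence decidable in EI''. Under (CAP)
   the collection AB is itself a collection of distinguished extensions, and an
   unbounded search for an amalgamation diagram computes the witness function. *)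

From mathcomp Require Import all_boot zify.
From Stdlib Require Cantor List.
From Stdlib Require Import ClassicalEpsilon.
Require Import Defs.

Set Implicit Arguments.
Unset Strict Implicit.
Unset Printing Implicit Defensive.

(** * Relative computability *)

(** Classical truth value of an arbitrary proposition, so that decidability relative to an oracle
    becomes computability of a numerical function. *)
Definition asbool (P : Prop) : bool :=
  if excluded_middle_informative P then true else false.

Lemma asboolP (P : Prop) : reflect P (asbool P).
Proof. by rewrite /asbool; case: excluded_middle_informative => ?; constructor. Qed.

Lemma unpairlK x y : unpairl (pair_code x y) = x.
Proof. by rewrite /unpairl /pair_code Cantor.cancel_of_to. Qed.

Lemma unpairrK x y : unpairr (pair_code x y) = y.
Proof. by rewrite /unpairr /pair_code Cantor.cancel_of_to. Qed.

Lemma pair_codeK n : pair_code (unpairl n) (unpairr n) = n.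
Proof.
by rewrite /unpairl /unpairr /pair_code -surjective_pairing Cantor.cancel_to_of.
Qed.

Definition unpairE := (unpairlK, unpairrK).

Lemma pair_code_inj x y x' y' :
  pair_code x y = pair_code x' y' -> x = x' /\ y = y'.
Proof.
move=> e; split; first by rewrite -(unpairlK x y) e unpairlK.
by rewrite -(unpairrK x y) e unpairrK.
Qed.

Lemma leq_pair_code x y : y <= pair_code x y.
Proof.
have /leP := Cantor.to_nat_non_decreasing x y; rewrite -/(pair_code x y).
by apply: leq_trans; apply/leP/PeanoNat.Nat.le_add_r.
Qed.

Lemma seq_code_inj : injective seq_code.
Proof.
by elim=> [|x s IHs] [|y t] //= [] /pair_code_inj [-> /IHs ->].
Qed.

Lemma leq_size_seq_code s : size s <= seq_code s.
Proof.
by elim: s => //= x s IHs; rewrite ltnS; apply: leq_trans IHs (leq_pair_code _ _).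
Qed.

(** Leaves have numbers below 5, and the offsets 5, 6, 7, 8 of the other constructors have distinct
    residues modulo 4. *)
Lemma encode_inj : injective encode.
Proof.
have cancel4 k x y : k + 4 * x = k + 4 * y -> x = y by lia.
elim=> [||||| c1 IH1 c2 IH2| c1 IH1 c2 IH2| c1 IH1 c2 IH2| c1 IH1];
  case=> [||||| d1 d2| d1 d2| d1 d2| d1] /= e; try done; try (exfalso; lia);
  move: e => /cancel4.
- by case/pair_code_inj=> /IH1 -> /IH2 ->.
- by case/pair_code_inj=> /IH1 -> /IH2 ->.
- by case/pair_code_inj=> /IH1 -> /IH2 ->.
- by move/IH1=> ->.
Qed.

Lemma WE S c x : W S (encode c) x <-> exists y, eval S c x y.
Proof.
split=> [[y [d /encode_inj ->]]|[y ecy]]; first by exists y.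
by exists y, c.
Qed.

(** By induction on the program. For [CMu], if two outputs differed, the smaller one would be both a
    zero and a positive value of the searched function. *)
Lemma eval_fun S c x y z : eval S c x y -> eval S c x z -> y = z.
Proof.
elim: c x y z => [||||| c1 IH1 c2 IH2| c1 IH1 c2 IH2| c1 IH1 c2 IH2| c1 IH1] x y z /=.
- by move=> -> ->.
- by move=> -> ->.
- by move=> -> ->.
- by move=> -> ->.
- by case=> [] [Sx ->] [] [Sx' ->].
- move=> [y1 [y2 [ey1 ey2 ->]]] [z1 [z2 [ez1 ez2 ->]]].
  by rewrite (IH1 _ _ _ ey1 ez1) (IH2 _ _ _ ey2 ez2).
- move=> [u eu ey] [v ev ez]; rewrite (IH2 _ _ _ eu ev) in ey.
  exact: IH1 ey ez.
- elim: (unpairr x) y z => [|n IHn] y z /=; first exact: IH1.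
  move=> [u eu ey] [v ev ez]; rewrite (IHn _ _ eu ev) in ey.
  exact: IH2 ey ez.
- move=> [ey lty] [ez ltz]; case: (ltngtP y z) => // ltyz.
  + by have [k ek] := ltz _ ltyz; have := IH1 _ _ _ ey ek.
  + by have [k ek] := lty _ ltyz; have := IH1 _ _ _ ez ek.
Qed.

Definition computable_in (S : nat -> Prop) (f : nat -> nat) : Prop :=
  exists c, forall x, eval S c x (f x).

Definition decidable_in (S : nat -> Prop) (A : nat -> Prop) : Prop :=
  computable_in S (fun x => asbool (A x)).

(** * Closure properties of computability and decidability relative to an oracle *)

Section Comp.
Variable S : nat -> Prop.
Implicit Types f g : nat -> nat.

Lemma comp_ext f g : f =1 g -> computable_in S f -> computable_in S g.
Proof. by move=> fg [c cf]; exists c => x; rewrite -fg. Qed.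

Lemma comp_id : computable_in S id.
Proof.
(* The identity is not among the basic programs; pairing the two projections recomputes the
   argument. *)
by exists (CPair CLeft CRight) => x /=; exists (unpairl x), (unpairr x);
  rewrite pair_codeK.
Qed.

Lemma comp_comp f g : computable_in S f -> computable_in S g ->
  computable_in S (fun x => f (g x)).
Proof. by move=> [c cf] [d dg]; exists (CComp c d) => x /=; exists (g x). Qed.

Lemma comp_succ f : computable_in S f -> computable_in S (fun x => (f x).+1).
Proof. by apply: comp_comp; exists CSucc. Qed.

Lemma comp_const n : computable_in S (fun=> n).
Proof. by elim: n => [|n]; [exists CZero | apply: comp_succ]. Qed.

Lemma comp_unpairl f : computable_in S f -> computable_in S (fun x => unpairl (f x)).
Proof. by apply: comp_comp; exists CLeft. Qed.

Lemma comp_unpairr f : computable_in S f -> computable_in S (fun x => unpairr (f x)).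
Proof. by apply: comp_comp; exists CRight. Qed.

Lemma comp_pair f g : computable_in S f -> computable_in S g ->
  computable_in S (fun x => pair_code (f x) (g x)).
Proof. by move=> [c cf] [d dg]; exists (CPair c d) => x /=; exists (f x), (g x). Qed.

(** Primitive recursion with the input [x] as parameter. The argument [p] packs parameter, counter
    and previous value in the order used by [prim_rec]. Arithmetic and case distinction are derived
    from this. *)
Lemma comp_iteri (h : nat -> nat -> nat -> nat) f g :
    computable_in S f -> computable_in S g ->
    computable_in S (fun p => h (unpairl p) (unpairl (unpairr p)) (unpairr (unpairr p))) ->
  computable_in S (fun x => iteri (f x) (h x) (g x)).
Proof.
move=> [cf ef] [cg eg] [ch eh].
have [ci ei] := comp_id.
exists (CComp (CPrec cg ch) (CPair ci cf)) => x /=.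
exists (pair_code x (f x)); first by exists x, (f x).
rewrite !unpairE; elim: (f x) => //= n IHn.
by exists (iteri n (h x) (g x)) => //; have :=
  eh (pair_code x (pair_code n (iteri n (h x) (g x)))); rewrite !unpairE.
Qed.

Lemma comp_pred f : computable_in S f -> computable_in S (fun x => (f x).-1).
Proof.
move=> cf; apply: (@comp_ext (fun x => iteri (f x) (fun m _ => m) 0)).
  by move=> x; case: (f x).
apply: (comp_iteri (h := fun _ m _ => m)) => //; first exact: comp_const.
exact/comp_unpairl/comp_unpairr/comp_id.
Qed.

Lemma comp_add f g : computable_in S f -> computable_in S g ->
  computable_in S (fun x => f x + g x).
Proof.
move=> cf cg; apply: (@comp_ext (fun x => iteri (g x) (fun _ z => z.+1) (f x))).
  by move=> x; elim: (g x) => [|n IHn]; rewrite ?addn0 //= IHn addnS.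
apply: (comp_iteri (h := fun _ _ z => z.+1)) => //.
exact/comp_succ/comp_unpairr/comp_unpairr/comp_id.
Qed.

Lemma comp_sub f g : computable_in S f -> computable_in S g ->
  computable_in S (fun x => f x - g x).
Proof.
move=> cf cg; apply: (@comp_ext (fun x => iteri (g x) (fun _ z => z.-1) (f x))).
  by move=> x; elim: (g x) => [|n IHn]; rewrite ?subn0 //= IHn subnS.
apply: (comp_iteri (h := fun _ _ z => z.-1)) => //.
exact/comp_pred/comp_unpairr/comp_unpairr/comp_id.
Qed.

Lemma comp_mul f g : computable_in S f -> computable_in S g ->
  computable_in S (fun x => f x * g x).
Proof.
move=> cf cg; apply: (@comp_ext (fun x => iteri (g x) (fun _ z => f x + z) 0)).
  by move=> x; elim: (g x) => [|n IHn]; rewrite ?muln0 //= IHn mulnS.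
apply: (comp_iteri (h := fun x _ z => f x + z)) => //; first exact: comp_const.
apply: comp_add; last exact/comp_unpairr/comp_unpairr/comp_id.
exact/(comp_comp cf)/comp_unpairl/comp_id.
Qed.

Lemma comp_iter (h : nat -> nat) f g :
  computable_in S f -> computable_in S g -> computable_in S h ->
    computable_in S (fun x => iter (f x) h (g x)).
Proof.
move=> cf cg ch; apply: (comp_ext (f := fun x => iteri (f x) (fun _ => h) (g x))) => [x|].
  by elim: (f x) => //= n ->.
apply: (comp_iteri (h := fun _ _ => h)) => //.
exact/(comp_comp ch)/comp_unpairr/comp_unpairr/comp_id.
Qed.

Lemma comp_if0 f g h : computable_in S f -> computable_in S g -> computable_in S h ->
  computable_in S (fun x => if f x is 0 then g x else h x).
Proof.
move=> cf cg ch; apply: (comp_ext (f :=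
  fun x => iteri (f x) (fun _ _ => h x) (g x))) => [x|].
  by case: (f x).
apply: (comp_iteri (h := fun x _ _ => h x)) => //.
exact/(comp_comp ch)/comp_unpairl/comp_id.
Qed.

Lemma dec_bool (A : nat -> Prop) (f : pred nat) :
  (forall x, f x <-> A x) -> computable_in S (fun x => f x) -> decidable_in S A.
Proof.
move=> fA; apply: comp_ext => x; congr nat_of_bool.
by apply/idP/asboolP => /fA.
Qed.

Lemma dec_ext (A B : nat -> Prop) : (forall x, A x <-> B x) -> decidable_in S A ->
  decidable_in S B.
Proof.
move=> AB; apply: dec_bool => x.
by split=> [/asboolP /AB | /AB /asboolP].
Qed.

Lemma dec_eq f g : computable_in S f -> computable_in S g ->
  decidable_in S (fun x => f x = g x).
Proof.
move=> cf cg; apply: (dec_bool (f := fun x => f x == g x)).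
  by move=> x; split=> /eqP.
(* Subtraction is truncated, so the inner sum vanishes exactly when the two values agree. *)
apply: (comp_ext (f := fun x => 1 - ((f x - g x) + (g x - f x)))).
  by move=> x; rewrite eqn_leq -!subn_eq0 -addn_eq0; case: (_ + _).
by apply: comp_sub; [apply: comp_const | apply: comp_add; apply: comp_sub].
Qed.

Lemma dec_not (A : nat -> Prop) : decidable_in S A -> decidable_in S (fun x => ~ A x).
Proof.
move=> dA; apply: (dec_bool (f := fun x => ~~ asbool (A x))).
  by move=> x; case: asboolP; split.
apply: (comp_ext (f := fun x => 1 - asbool (A x))); first by move=> x; case: (asbool _).
exact/comp_sub/dA/comp_const.
Qed.

Lemma dec_and (A B : nat -> Prop) : decidable_in S A -> decidable_in S B ->
  decidable_in S (fun x => A x /\ B x).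
Proof.
move=> dA dB; apply: (dec_bool (f := fun x => asbool (A x) && asbool (B x))).
  move=> x; split=> [/andP [/asboolP Ax /asboolP Bx] | [Ax Bx]] //.
  by apply/andP; split; apply/asboolP.
by apply: comp_ext (comp_mul dA dB) => x; rewrite mulnb.
Qed.

Lemma dec_imp (A B : nat -> Prop) : decidable_in S A -> decidable_in S B ->
  decidable_in S (fun x => A x -> B x).
Proof.
move=> dA dB; apply: dec_ext (dec_not (dec_and dA (dec_not dB))) => x.
by split=> [nAB Ax|AB [Ax]]; [apply: NNPP => nB; apply: nAB | apply; apply: AB].
Qed.

Lemma dec_comp (A : nat -> Prop) f : decidable_in S A -> computable_in S f ->
  decidable_in S (fun x => A (f x)).
Proof. exact: comp_comp. Qed.

Lemma dec_oracle : decidable_in S S.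
Proof.
by exists COracle => x /=; case: asboolP; [left | right].
Qed.

Lemma dec_turing_le (A : nat -> Prop) : decidable_in S A -> turing_le A S.
Proof.
move=> [c cA]; exists c => x; have := cA x.
by case: asboolP => Ax; split.
Qed.

(** [CMu] looks for a zero, hence it is applied to the characteristic function of the complement.
    The graph is described completely because the witness function for (CAP) must match its program
    also where it is undefined. *)
Lemma dec_search (A : nat -> Prop) : decidable_in S A ->
  exists c, forall x y, eval S c x y <->
    A (pair_code x y) /\ forall m, m < y -> ~ A (pair_code x m).
Proof.
move=> /dec_not [c cA]; exists (CMu c) => x y /=.
have evA z k : eval S c z k <-> k = ~~ asbool (A z).
  have := cA z; have -> : asbool (~ A z) = ~~ asbool (A z) by case: asboolP;
    case: asboolP.
  by move=> cz; split=> [/(eval_fun cz) -> | ->].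
rewrite evA; split=> [[e0 epos]|[/asboolP Axy nA]].
  split=> [|m /epos [k]]; first by apply/asboolP; move: e0; case: (asbool _).
  by rewrite evA; case: asboolP.
split=> [|m /nA Am]; first by rewrite Axy.
by exists 0; rewrite evA; case: asboolP.
Qed.

Lemma search_total (A : nat -> Prop) x :
  (exists y, A (pair_code x y) /\ forall m, m < y -> ~ A (pair_code x m)) <->
  exists y, A (pair_code x y).
Proof.
split=> [[y [Ay _]]|[y Ay]]; first by exists y.
have ex : exists n, asbool (A (pair_code x n)) by exists y; apply/asboolP.
exists (ex_minn ex); case: ex_minnP => m /asboolP Am minm; split=> // k ltkm Ak.
by have /minm := introT (asboolP _) Ak; rewrite leqNgt ltkm.
Qed.

Lemma dec_ce_in (A : nat -> Prop) : decidable_in S A -> ce_in S A.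
Proof.
(* The searched condition ignores the candidate: the search stops at 0 if [A x] holds and diverges
   otherwise. *)
move=> dA; have [c cP] := dec_search (dec_comp dA (comp_unpairl comp_id)).
exists (encode c) => x; rewrite WE; split=> [Ax|[y /cP []]]; last by rewrite unpairE.
have [y Ay] := (search_total (fun p => A (unpairl p)) x).2
  (ex_intro _ 0 (eq_ind_r A Ax (unpairlK x 0))).
by exists y; apply/cP.
Qed.

End Comp.

(** * Parametrisation of programs and the Turing jump *)

(* The program for [s x] is [c] composed with the constant program [x]; the
   number 6 + 4 * ⟨p, q⟩ is the Goedel number of a composition. *)
Lemma smn S c :
  exists2 s, forall S', computable_in S' s & forall x z, W S (s x) z <->
    exists y, eval S c x y.
Proof.
(* The numbers 0 and 1 encode [CZero] and [CSucc], so [const n] is the number of a program with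
   constant output [n]. *)
pose const n := iteri n (fun _ e => 6 + 4 * ⟨1, e⟩) 0.
have constE n : exists2 d, encode d = const n & forall z y, eval S d z y <-> y = n.
  elim: n => [|n [d dE dP]]; first by exists CZero.
  exists (CComp CSucc d) => [|z y /=]; first by rewrite /= dE.
  split=> [[u /dP -> //]|->]; by exists n => //; apply/dP.
(* Only arithmetic on Goedel numbers is involved, so [s] is computable in every oracle, in
   particular in the jump of [S]. *)
exists (fun x => 6 + 4 * pair_code (encode c) (const x)) => [S'|x z].
  have comp_node f g : computable_in S' f -> computable_in S' g ->
      computable_in S' (fun x => 6 + 4 * pair_code (f x) (g x)).
    move=> cf cg; apply: comp_add (comp_const _ 6) _.
    by apply: comp_mul (comp_const _ 4) _; apply: comp_pair.
  apply: (comp_node) (comp_const _ _) _.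
  apply: (comp_iteri (h := fun _ _ e => 6 + 4 * ⟨1, e⟩) (comp_id _) (comp_const _ 0)).
  apply: comp_node (comp_const _ _) _.
  exact/comp_unpairr/comp_unpairr/comp_id.
have [d <- dP] := constE x.
rewrite -[_ + _]/(encode (CComp c d)) WE; split=> [[y [u /dP ->]]|[y exy]];
  exists y => //.
by exists x => //; apply/dP.
Qed.

(** The program with index [s x] ignores its input and searches for a [w] with [P x w]. It halts on
    its own index iff such a [w] exists, so one query to the jump decides the question. *)
Lemma dec_jump_ex S (P : nat -> nat -> Prop) :
    decidable_in S (fun p => P (unpairl p) (unpairr p)) ->
  decidable_in (jump S) (fun x => exists w, P x w).
Proof.
move=> dP; have [c cP] := dec_search dP.
have [s cs sP] := smn S c.
apply: dec_ext (dec_comp (dec_oracle _) (cs (jump S))) => x.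
rewrite /jump sP; split=> [[y /cP [Pxy _]]|[y Pxy]].
  by exists y; rewrite !unpairE in Pxy.
have [|z /cP] := (search_total (fun p => P (unpairl p) (unpairr p)) x).2;
  last by exists z.
by exists y; rewrite !unpairE.
Qed.

Lemma dec_jump S (A : nat -> Prop) : decidable_in S A -> decidable_in (jump S) A.
Proof.
move=> dA; apply: dec_ext (dec_jump_ex (P := fun x _ => A x) _).
  by move=> x; split=> [[]|Ax] //; exists 0.
exact/(dec_comp dA)/comp_unpairl/comp_id.
Qed.

(** * Reversed concatenation of coded tuples *)

Definition catrev_step (p : nat) : nat :=
  if unpairl p is 0 then p
  else pair_code (unpairr (unpairl p).-1)
                 (pair_code (unpairl (unpairl p).-1) (unpairr p)).+1.

Definition catrev_code (s t : nat) : nat :=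
  unpairr (iter s catrev_step (pair_code s t)).

(** Each step moves the head of the first list onto the second. The loop runs as often as the code
    of [s] says, which is at least the length of [s]; surplus steps idle because a pair with empty
    first list is a fixed point. *)
Lemma catrev_codeE s t : catrev_code (seq_code s) (seq_code t) = seq_code (catrev s t).
Proof.
suff H n : size s <= n -> iter n catrev_step (pair_code (seq_code s) (seq_code t))
    = pair_code 0 (seq_code (catrev s t)).
  by rewrite /catrev_code H ?unpairE // leq_size_seq_code.
have stepE a b : catrev_step (pair_code a b) = if a is 0 then pair_code a b
    else pair_code (unpairr a.-1) (pair_code (unpairl a.-1) b).+1.
  by rewrite /catrev_step !unpairE.
elim: n s t => [|n IHn] [|x s] t // les; rewrite iterSr stepE; first exact: (IHn [::]).
by rewrite [seq_code _]/= [_.+1.-1]/= !unpairE (IHn s (x :: t)).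
Qed.

Lemma comp_catrev S f g :
  computable_in S f -> computable_in S g ->
    computable_in S (fun x => catrev_code (f x) (g x)).
Proof.
move=> cf cg; apply/comp_unpairr/comp_iter => //; first exact: comp_pair.
have cl := comp_unpairl (comp_id S).
apply: comp_if0 (cl) (comp_id S) _; apply: comp_pair.
  exact/comp_unpairr/comp_pred.
apply/comp_succ/comp_pair; first exact/comp_unpairl/comp_pred.
exact/comp_unpairr/comp_id.
Qed.
(** * Embeddings of structures *)

Lemma In_tnth (T : Type) n (u : n.-tuple T) y : List.In y u -> exists k, tnth u k = y.
Proof.
move=> yu; have [i [ltiu ei]] : exists i, i < size u /\ nth y u i = y.
  elim: (tval u) yu => //= x s IHs [->|/IHs [i [ltis ei]]]; first by exists 0.
  by exists i.+1.
by rewrite size_tuple in ltiu; exists (Ordinal ltiu); rewrite (tnth_nth y).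
Qed.

Lemma eq_map_In (T U : Type) (h h' : T -> U) s :
  map h s = map h' s -> forall y, List.In y s -> h y = h' y.
Proof.
elim: s => //= x s IHs [hx /IHs hs] y [<- //|]; exact: hs.
Qed.

Section Structures.
Variable L : language.
Implicit Types A B C : structure L.

Lemma embedding_comp A B C (g : B -> C) (f : A -> B) :
  is_embedding g -> is_embedding f -> is_embedding (g \o f).
Proof.
have mapE n (t : n.-tuple A) : map_tuple g (map_tuple f t) = map_tuple (g \o f) t.
  by apply: val_inj; rewrite /= -map_comp.
move=> [gi gr gf] [fi fr ff]; split=> [|r t|s t]; first exact: inj_comp.
  by rewrite fr gr mapE.
by rewrite /= ff gf mapE.
Qed.

Lemma embedding_id A : is_embedding (@id A).
Proof.
have mapE n (t : n.-tuple A) : map_tuple id t = t by apply: val_inj; rewrite /= map_id.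
by split=> // [r t|f t]; rewrite mapE.
Qed.

Lemma teval_embedding A B (h : A -> B) n (u : n.-tuple A) (t : term L n) :
  is_embedding h -> h (teval u t) = teval (map_tuple h u) t.
Proof.
move=> [_ _ hf]; elim: t => [k|f args IH] /=; first by rewrite tnth_map.
rewrite hf; congr fun_of; apply: eq_from_tnth => k.
by rewrite tnth_map !tnth_mktuple.
Qed.

Lemma simeq_map A B (h : A -> B) (a : seq A) : is_embedding h -> simeq a (map h a).
Proof.
move=> he; exists (size a), (in_tuple a), (map_tuple h (in_tuple a)); split=> //.
have [hi hr hf] := he; case=> [s t|r args] /=.
  rewrite -!teval_embedding //; split=> [-> //|]; exact: hi.
rewrite hr; suff -> : map_tuple h [tuple teval (in_tuple a) (args k) | k < rar r]
   = [tuple teval (map_tuple h (in_tuple a)) (args k) | k < rar r] by [].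
by apply: eq_from_tnth => k; rewrite tnth_map !tnth_mktuple teval_embedding.
Qed.

Lemma simeq_refl A (a : seq A) : simeq a a.
Proof. by rewrite -{2}[a]map_id; apply/simeq_map/embedding_id. Qed.

(** The values of terms at [u] form a set that contains [u] and is closed under the functions; the
    terms for the arguments are picked by choice. *)
Lemma cl_teval A n (u : n.-tuple A) x : cl u x -> exists t : term L n, teval u t = x.
Proof.
move=> ux; refine (ux (fun x => exists t, teval u t = x) _ _) => [f t IH|y yu].
  2: by have [k <-] := In_tnth yu; exists (Var L k).
exists (App (fun k => sval (constructive_indefinite_description _ (IH k)))) => /=.
congr fun_of; apply: eq_from_tnth => k; rewrite tnth_mktuple.
by case: constructive_indefinite_description.
Qed.

(** Each element is the value at [a] of some chosen term and is sent to the value of that term at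
    [b]. Equational atoms make the result independent of the choice and the map injective and
    compatible with functions; relational atoms give compatibility with relations; variables show
    that [a] goes to [b]. *)
Lemma simeq_embedding A B (a : seq A) (b : seq B) :
    (forall x, cl a x) -> simeq a b ->
  exists h : A -> B, is_embedding h /\ map h a = b.
Proof.
move=> gena [n [u [v [au -> uv]]]]; rewrite {a}au in gena *.
pose tm x := sval (constructive_indefinite_description _ (cl_teval (gena x))).
have tmK x : teval u (tm x) = x by rewrite /tm; case: constructive_indefinite_description.
have teqE s t : teval u s = teval u t <-> teval v s = teval v t := uv (AEq s t).
exists (fun x => teval v (tm x)); split; first split.
- by move=> x y /teqE; rewrite !tmK.
- move=> r t; have := uv (ARel (fun k => tm (tnth t k))) => /=.
  have -> : [tuple teval u (tm (tnth t k)) | k < rar r] = t.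
    by apply: eq_from_tnth => k; rewrite tnth_mktuple.
  have -> // : [tuple teval v (tm (tnth t k)) | k < rar r]
      = map_tuple (fun x => teval v (tm x)) t.
  by apply: eq_from_tnth => k; rewrite tnth_mktuple tnth_map.
- move=> f t.
  have -> : fun_of (map_tuple (fun x => teval v (tm x)) t)
      = teval v (App (fun k => tm (tnth t k))).
    rewrite [RHS]/=; apply: (f_equal (@fun_of _ _ _)).
    by apply: eq_from_tnth => k; rewrite [RHS]tnth_mktuple tnth_map.
  apply/teqE; rewrite tmK /=; apply: (f_equal (@fun_of _ _ _)).
  by apply: eq_from_tnth => k; rewrite tnth_mktuple.
suff vE : v = map_tuple (fun x => teval v (tm x)) u by rewrite [in RHS]vE.
apply: eq_from_tnth => k; rewrite tnth_map; apply/esym.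
exact/(teqE _ (Var L k))/tmK.
Qed.

Lemma embedding_ext A B (h h' : A -> B) (a : seq A) :
    (forall x, cl a x) -> is_embedding h -> is_embedding h' ->
  map h a = map h' a -> h =1 h'.
Proof.
move=> gena [_ _ hf] [_ _ hf'] hh' x.
refine (gena x (fun x => h x = h' x) _ (eq_map_In hh')) => f t IH; rewrite hf hf'.
by congr fun_of; apply: eq_from_tnth => k; rewrite !tnth_map.
Qed.

(** A span over [B] is precomposed with the isomorphism, amalgamated over [A], and surjectivity
    transfers commutativity back. *)
Lemma amalgamation_base_iso (K : structure L -> Prop) A B :
  age K -> isomorphic A B -> amalgamation_base K A -> amalgamation_base K B.
Proof.
move=> hK AB [KA baseA]; split; first exact: age_iso KA AB.
move=> C D fC fD KC KD fCe fDe; have [h [he hs]] := AB.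
have [E [gC [gD [KE gCe gDe eqg]]]] :=
  baseA C D (fC \o h) (fD \o h) KC KD (embedding_comp fCe he) (embedding_comp fDe he).
exists E, gC, gD; split=> // y; have [x <-] := hs y; exact: eqg.
Qed.

End Structures.
(** * Queries to the embedding information *)

Lemma elts_code_inj (L : language) (M : omega_structure L) : injective (@elts_code L M).
Proof. by move=> a b /seq_code_inj; apply: inj_map => x y; apply: val_inj. Qed.

Lemma elts_code_catrev (L : language) (M : omega_structure L) (a b : seq M) :
  elts_code (catrev a b) = catrev_code (elts_code a) (elts_code b).
Proof. by rewrite /elts_code catrev_codeE !catrevE map_cat map_rev. Qed.

Lemma In_catrev (T : Type) (a b : seq T) y :
  List.In y a \/ List.In y b -> List.In y (catrev a b).
Proof.
elim: a b => [|x a IHa] b /=; first by case.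
by move=> yab; apply: IHa => /=; tauto.
Qed.

Lemma catrev_inj (T : Type) (a b c d : seq T) :
  size a = size c -> catrev a b = catrev c d -> a = c /\ b = d.
Proof.
by elim: a b c d => [|x a IHa] b [|z c] d //= [sac] /(IHa _ _ _ sac) [-> [-> ->]].
Qed.

Lemma map_catrev (T U : Type) (h : T -> U) a b :
  map h (catrev a b) = catrev (map h a) (map h b).
Proof. by rewrite !catrevE map_cat map_rev. Qed.

Section Age.
Variables (L : language) (K : structure L -> Prop) (KK : computable_age K).
Hypothesis hK : age K.

Lemma II_inj : injective (II KK).
Proof. by move=> i j /pair_code_inj [_ /pair_code_inj []]. Qed.

Lemma unpairl_II i : unpairl (II KK i) = elts_code (gens KK i).
Proof. exact: unpairlK. Qed.

(* A suffix q marks the translation of a notion about the elements of the age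
   into a property of codes expressed by queries to EI. *)
Definition simeqq (x s y t : nat) : Prop := EI KK ⟨x, s, y, t⟩.

Lemma simeqq_inv x s y t : simeqq x s y t ->
  exists i (b : seq (model KK i)) j (c : seq (model KK j)),
    [/\ x = II KK i, s = elts_code b, y = II KK j, t = elts_code c & simeq b c].
Proof.
move=> [i [b [j [c [bc]]]]].
by move=> /pair_code_inj [-> /pair_code_inj [-> /pair_code_inj [-> ->]]];
  exists i, b, j, c.
Qed.

Lemma simeqqE i (b : seq (model KK i)) j (c : seq (model KK j)) :
  simeqq (II KK i) (elts_code b) (II KK j) (elts_code c) <-> simeq b c.
Proof.
split=> [|bc]; last by exists i, b, j, c.
move=> /simeqq_inv [i' [b' [j' [c' [/II_inj ii' + /II_inj jj']]]]].
(* The tuples live in types depending on the indices; eliminating the index equalities makes them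
   comparable. *)
by case: _ / ii' b' => b'; case: _ / jj' c' => c' /elts_code_inj -> /elts_code_inj ->.
Qed.

(** By reflexivity of [simeq], this recognises that [y] codes a triple and [s] a tuple of its
    model. *)
Definition memq (y s : nat) : Prop := simeqq y s y s.

Lemma memqE i (b : seq (model KK i)) : memq (II KK i) (elts_code b).
Proof. exact/simeqqE/simeq_refl. Qed.

Lemma memq_inv y s : memq y s ->
  exists i (b : seq (model KK i)), y = II KK i /\ s = elts_code b.
Proof. by move=> /simeqq_inv [i [b [_ [_ [-> -> _ _ _]]]]]; exists i, b. Qed.

Lemma memq_elts i s : memq (II KK i) s -> exists b : seq (model KK i), s = elts_code b.
Proof.
by move=> /memq_inv [j [b [/II_inj ij ->]]]; case: _ / ij b => b; exists b.
Qed.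

(** The code of a triple contains its generating tuple, which [unpairl x] extracts. *)
Definition embq (x y s : nat) : Prop := simeqq x (unpairl x) y s.

Lemma embqE i j (c : seq (model KK j)) :
  embq (II KK i) (II KK j) (elts_code c) <-> simeq (gens KK i) c.
Proof. by rewrite /embq unpairl_II simeqqE. Qed.

Lemma embq_inv x y s : embq x y s ->
  exists j (c : seq (model KK j)), y = II KK j /\ s = elts_code c.
Proof. by move=> /simeqq_inv [_ [_ [j [c [_ _ -> -> _]]]]]; exists j, c. Qed.

(* With x, y, z the codes of three triples, s, t tuples of the first two and
   u, v the ranges of embeddings into z: these send s and t to the same tuple e. *)
Definition amalgq (x s y t z u v e : nat) : Prop :=
  [/\ memq z e,
      simeqq x (catrev_code (unpairl x) s) z (catrev_code u e) &
      simeqq y (catrev_code (unpairl y) t) z (catrev_code v e)].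

Lemma simeq_encodes i j (c : seq (model KK j)) : simeq (gens KK i) c ->
  exists h : model KK i -> model KK j, is_embedding h /\ map h (gens KK i) = c.
Proof. by apply: simeq_embedding => x; apply: model_generated. Qed.

(* The tuple [catrev (gens i) c] again generates [model i], and an embedding is
   determined by its values on [gens i]. *)
Lemma map_embedding_simeq i j (h : model KK i -> model KK j) c e :
    is_embedding h ->
  map h c = e <-> simeq (catrev (gens KK i) c) (catrev (map h (gens KK i)) e).
Proof.
move=> he; split=> [<-|sim].
  by rewrite -map_catrev; apply: simeq_map.
have gen x : cl (catrev (gens KK i) c) x.
  move=> P Pf Pc; apply: (model_generated x) => // y ya.
  by apply/Pc/In_catrev; left.
have [h' [he' ]] := simeq_embedding gen sim.
rewrite map_catrev => /catrev_inj [|hg <-]; first by rewrite !size_map.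
by apply/eq_map/(embedding_ext (@model_generated _ _ KK i) he he'); rewrite hg.
Qed.

(** The encoded map is unique, being determined on generators, so any encoding [h] may replace the
    existential one. *)
Lemma emb_graphE (F : pemb KK) (h : model KK (pdom F) -> model KK (pcod F)) x y :
  encodes h -> emb_graph F x y <-> exists u, elt u = x /\ elt (h u) = y.
Proof.
move=> [he hg]; split=> [[h' [[he' hg'] [u [ux uy]]]]|[u [ux uy]]].
  exists u; split=> //.
  by rewrite (embedding_ext (@model_generated _ _ KK _) he he') // hg hg'.
by exists h; split; last exists u.
Qed.

Lemma elt_inj i : injective (@elt L (model KK i)).
Proof. exact: val_inj. Qed.

Lemma is_emb_encodes (F : pemb KK) : is_emb F -> exists h, @encodes _ _ _ F h.
Proof. exact: simeq_encodes. Qed.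

Lemma comp_graphE (i j l : nat) (c : seq (model KK j)) (d : seq (model KK l))
    (f : model KK i -> model KK j) (g : model KK j -> model KK l) x z :
    is_embedding f -> map f (gens KK i) = c ->
    is_embedding g -> map g (gens KK j) = d ->
  comp_graph (PEmb j d) (PEmb i c) x z <-> exists u, elt u = x /\ elt (g (f u)) = z.
Proof.
move=> fe fg ge gg.
have fP := emb_graphE (F := PEmb i c) _ _ (conj fe fg).
have gP := emb_graphE (F := PEmb j d) _ _ (conj ge gg).
split=> [[y [/fP [u [ux uy]] /gP [v [vy vz]]]]|[u [ux uz]]].
  by exists u; split=> //; rewrite -vz (elt_inj (etrans uy (esym vy))).
by exists (elt (f u)); split; [apply/fP; exists u | apply/gP; exists (f u)].
Qed.

(** The witness [e] is the code of the common image; by [map_embedding_simeq] the two queries force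
    it to be the image of [c0] and of [c1]. *)
Lemma amalgqE j k l c0 c1 (g0 : model KK j -> model KK l) (g1 : model KK k ->
  model KK l) :
    is_embedding g0 -> is_embedding g1 ->
  (exists e, amalgq (II KK j) (elts_code c0) (II KK k) (elts_code c1) (II KK l)
     (elts_code (map g0 (gens KK j))) (elts_code (map g1 (gens KK k))) e) <->
  map g0 c0 = map g1 c1.
Proof.
move=> g0e g1e; split=> [[e []] | eqg].
  move=> /memq_elts [b ->]; rewrite !unpairl_II -!elts_code_catrev !simeqqE.
  by rewrite -!map_embedding_simeq // => -> ->.
exists (elts_code (map g0 c0)); split; first exact: memqE.
  by rewrite unpairl_II -!elts_code_catrev simeqqE -map_embedding_simeq.
by rewrite unpairl_II -!elts_code_catrev simeqqE -map_embedding_simeq.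
Qed.

Lemma comp_graph_eqE i j k l (f0 : model KK i -> model KK j) (f1 : model KK i ->
  model KK k)
    (g0 : model KK j -> model KK l) (g1 : model KK k -> model KK l) :
    is_embedding f0 -> is_embedding f1 -> is_embedding g0 -> is_embedding g1 ->
  (forall x z,
     comp_graph (PEmb j (map g0 (gens KK j))) (PEmb i (map f0 (gens KK i))) x z <->
     comp_graph (PEmb k (map g1 (gens KK k))) (PEmb i (map f1 (gens KK i))) x z) <->
  map g0 (map f0 (gens KK i)) = map g1 (map f1 (gens KK i)).
Proof.
move=> f0e f1e g0e g1e.
have P0 x z := comp_graphE x z f0e erefl g0e erefl.
have P1 x z := comp_graphE x z f1e erefl g1e erefl.
rewrite -!map_comp; split=> [eqg|].
  apply: eq_map => u; have /P1 [v [/elt_inj -> /elt_inj /= ->]] // :=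
    (eqg (elt u) (elt (g0 (f0 u)))).1 ((P0 _ _).2 (ex_intro _ u (conj erefl erefl))).
move=> /(embedding_ext (@model_generated _ _ KK _) (embedding_comp g0e f0e)
          (embedding_comp g1e f1e)) eqg x z.
have {}eqg u : g0 (f0 u) = g1 (f1 u) := eqg u.
by rewrite P0 P1; split=> [] [u [<- <-]]; exists u; rewrite eqg.
Qed.

(** * Amalgamation bases and diagrams as conditions on codes *)

Definition baseq (y : nat) : Prop := forall z0 s0 z1 s1,
  embq y z0 s0 -> embq y z1 s1 -> exists l t0 t1 e,
    [/\ embq z0 l t0, embq z1 l t1 & amalgq z0 s0 z1 s1 l t0 t1 e].

(** Every structure of the age is isomorphic to some [model KK l], so spans and amalgams can be
    moved into the representation, where they are given by numbers. Commutativity is checked on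
    generators through [amalgqE]. *)
Lemma baseqE i : amalgamation_base K (model KK i) <-> baseq (II KK i).
Proof.
split=> [[_ base]|base].
  move=> z0 s0 z1 s1 E0 E1.
  have [j [c0 [z0E s0E]]] := embq_inv E0; have [k [c1 [z1E s1E]]] := embq_inv E1.
  subst; move: E0 E1; rewrite !embqE => /simeq_encodes [f0 [f0e <-]]
    /simeq_encodes [f1 [f1e <-]].
  have [D [gB [gC [KD gBe gCe eqg]]]] :=
    base _ _ f0 f1 (model_in_age KK j) (model_in_age KK k) f0e f1e.
  have [l [h [he _]]] := model_complete KK KD.
  have g0e := embedding_comp he gBe; have g1e := embedding_comp he gCe.
  have [|e eP] := (amalgqE (map f0 (gens KK i)) (map f1 (gens KK i)) g0e g1e).2.
    by rewrite -!map_comp; apply: eq_map => u /=; rewrite [gB _]eqg.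
  exists (II KK l), (elts_code (map (h \o gB) (gens KK j))),
    (elts_code (map (h \o gC) (gens KK k))), e.
  by split=> //; apply/embqE/simeq_map.
split; first exact: model_in_age.
move=> B C fB fC KB KC fBe fCe.
have [j [b [be _]]] := model_complete KK KB; have [k [c [ce _]]] := model_complete KK KC.
have f0e := embedding_comp be fBe; have f1e := embedding_comp ce fCe.
have := base (II KK j) (elts_code (map (b \o fB) (gens KK i)))
     (II KK k) (elts_code (map (c \o fC) (gens KK i))).
rewrite !embqE => /(_ (simeq_map _ f0e) (simeq_map _ f1e)).
move=> [z [s0 [s1 [e [F0 F1 eP]]]]].
have [l [d0 [zE s0E]]] := embq_inv F0; subst.
have [l1 [d1 [/II_inj le s1E]]] := embq_inv F1; subst l1 s1.
move: F0 F1; rewrite !embqE => /simeq_encodes [g0 [g0e g0g]]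
  /simeq_encodes [g1 [g1e g1g]].
exists (model KK l), (g0 \o b), (g1 \o c); split.
- exact: model_in_age.
- exact: embedding_comp.
- exact: embedding_comp.
apply: (embedding_ext (@model_generated _ _ KK i)).
- exact: embedding_comp (embedding_comp g0e be) fBe.
- exact: embedding_comp (embedding_comp g1e ce) fCe.
rewrite -g0g -g1g in eP.
by have := (amalgqE _ _ g0e g1e).1 (ex_intro _ e eP); rewrite -!map_comp.
Qed.

(** The empty tuple has code 0, so the first query only tests that the domain is the code of a
    triple. *)
Definition pembq (n : nat) : Prop :=
  memq (unpairl n) 0 /\ memq (unpairl (unpairr n)) (unpairr (unpairr n)).

Lemma pembqE n : pembq n <-> exists F : pemb KK, n = pemb_code F.
Proof.
split=> [[/memq_inv [i [_ [xE _]]] /memq_inv [j [c [yE cE]]]]|[F ->]].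
  by exists (PEmb i c); rewrite /pemb_code /= -xE -yE -cE !pair_codeK.
rewrite /pembq /pemb_code !unpairE; split; last exact: memqE.
exact: (memqE (i := pdom F) [::]).
Qed.

Definition is_embq (n : nat) : Prop :=
  embq (unpairl n) (unpairl (unpairr n)) (unpairr (unpairr n)).

Lemma is_embqE (F : pemb KK) : is_embq (pemb_code F) <-> is_emb F.
Proof. by rewrite /is_embq /pemb_code !unpairE embqE. Qed.

Lemma pemb_codes_AB n : pemb_codes (AB (KK := KK)) n <->
  [/\ pembq n, is_embq n & baseq (unpairl (unpairr n))].
Proof.
split=> [[F [[Fe Fb] ->]]|[/pembqE [F ->] /is_embqE Fe]].
  split; [by apply/pembqE; exists F | exact/is_embqE | ].
  by rewrite /pemb_code !unpairE; apply/baseqE.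
by rewrite {1}/pemb_code !unpairE => /baseqE Fb; exists F.
Qed.

(** Mirrors [amalgamation_diagram], with equality of the composites certified by the tuple code [e].
    That [f0] and [f1] have the same domain is required separately wherever this is applied. *)
Definition diagq (f0 f1 g0 g1 e : nat) : Prop :=
  [/\ is_embq g0,
      unpairl g0 = unpairl (unpairr f0) /\ unpairl g1 = unpairl (unpairr f1),
      unpairl (unpairr g0) = unpairl (unpairr g1) &
      is_embq f0 /\ is_embq f1 -> is_embq g1 /\
        amalgq (unpairl g0) (unpairr (unpairr f0)) (unpairl g1) (unpairr (unpairr f1))
          (unpairl (unpairr g0)) (unpairr (unpairr g0)) (unpairr (unpairr g1)) e].

Lemma diagqE (F0 F1 G0 G1 : pemb KK) : potential_span F0 F1 ->
  (exists e, diagq (pemb_code F0) (pemb_code F1) (pemb_code G0) (pemb_code G1) e) <->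
  amalgamation_diagram F0 F1 G0 G1.
Proof.
move: F0 F1 G0 G1 => [i j c0] [i' k c1] [j' l d0] [k' l' d1].
rewrite /potential_span /= => ii'; subst i'.
rewrite /diagq /amalgamation_diagram.
have graphs : j' = j -> k' = k -> l = l' ->
  is_emb (PEmb i c0) -> is_emb (PEmb i c1) -> is_emb (PEmb j' d0) ->
    is_emb (PEmb k' d1) ->
  (exists e, amalgq (II KK j') (elts_code c0) (II KK k') (elts_code c1) (II KK l)
    (elts_code d0) (elts_code d1) e) <->
  (forall x z, comp_graph (PEmb j' d0) (PEmb i c0) x z <->
     comp_graph (PEmb k' d1) (PEmb i c1) x z).
  move=> jj kk ll; subst.
  move=> /is_emb_encodes /= [f0 [f0e /= <-]] /is_emb_encodes /= [f1 [f1e /= <-]].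
  move=> /is_emb_encodes /= [g0 [g0e /= <-]] /is_emb_encodes /= [g1 [g1e /= <-]].
  by rewrite amalgqE // comp_graph_eqE.
split=> [[e [/is_embqE G0e]]|[G0e [/= jj kk] /= ll eP]].
  move=> dds ll eP; move: dds ll; rewrite /pemb_code !unpairE /=.
  move=> [/II_inj jj /II_inj kk] /II_inj ll; split=> // -[_ F0e F1e].
  have [|/is_embqE G1e am] := eP; first by split; apply/is_embqE.
  split=> //; apply/graphs => //; exists e.
  by move: am; rewrite /pemb_code !unpairE.
have [[F0e F1e]|nspan] := classic (is_emb (PEmb i c0) /\ is_emb (PEmb i c1)); last first.
  (* Without a span the last clause is vacuous, and 0 is a dummy certificate. *)
  exists 0; split; [exact/is_embqE | | | by move=> [/is_embqE ? /is_embqE ?];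
    case: nspan].
    by rewrite /pemb_code !unpairE /= jj kk.
  by rewrite /pemb_code !unpairE /= ll.
have [|G1e /graphs [] // e am] := eP; first by split.
subst; exists e; split; [exact/is_embqE | | | move=> _; split; first exact/is_embqE];
  by rewrite /pemb_code !unpairE.
Qed.

(* Over a potential span which is not a span, the identity and any potential
   embedding form an amalgamation diagram. *)
Lemma diagq_ex (G0 G1 : pemb KK) : potential_span G0 G1 ->
    baseq (II KK (pdom G0)) ->
  exists H0 H1 e, diagq (pemb_code G0) (pemb_code G1)
    (@pemb_code _ _ KK H0) (@pemb_code _ _ KK H1) e.
Proof.
move=> dd base.
have [span|nspan] := classic (is_emb G0 /\ is_emb G1); last first.
  exists (PEmb (pcod G0) (gens KK (pcod G0))), (@PEmb _ _ KK (pcod G1) (pcod G0) [::]), 0.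
  split; [exact/is_embqE/simeq_refl | | | by move=> [/is_embqE ? /is_embqE ?];
    case: nspan];
    by rewrite /pemb_code !unpairE.
have [F0 F1] := span.
have [||z [s0 [s1 [e []]]]] := base (II KK (pcod G0)) (elts_code (prange G0))
  (II KK (pcod G1)) (elts_code (prange G1)).
- exact/embqE.
- by rewrite dd; apply/embqE.
move=> E0 E1 am.
have [l [d0 [zE s0E]]] := embq_inv E0; subst.
have [l1 [d1 [/II_inj le s1E]]] := embq_inv E1; subst l1 s1.
exists (PEmb (pcod G0) d0), (PEmb (pcod G1) d1), e.
split; rewrite /is_embq /pemb_code ?unpairE //=.
Qed.

(** Precomposition keeps the codomain and postcomposition with an isomorphism replaces it by an
    isomorphic one. Totality is (CAP), with the amalgamation base moved into the representation. *)
Lemma AB_distinguished : CAP K -> distinguished_extensions (AB (KK := KK)).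
Proof.
move=> cap; split.
- by move=> F [].
- move=> F H C [_ Fb] _ [[_ _ Ce] _ _ CF _]; split=> //.
  by rewrite CF.
- move=> F H C [_ Fb] [/is_emb_encodes [h [he hg]] hs] [[_ _ Ce] FH _ CH _]; split=> //.
  rewrite CH; apply: (amalgamation_base_iso hK) (_ : isomorphic (model KK (pdom H)) _) _.
    exists h; split=> // z; have [x] := hs z.
    by move=> /(emb_graphE _ _ (conj he hg)) [u [_ /elt_inj <-]]; exists u.
  by rewrite -FH.
move=> i; have [A' [h [Ab he]]] := cap _ (model_in_age KK i).
have [j [b [be bs]]] := model_complete KK Ab.1.
exists (PEmb i (map (b \o h) (gens KK i))); split=> //; split.
  exact/simeq_map/embedding_comp.
by apply: amalgamation_base_iso hK _ Ab; exists b.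
Qed.

(** The single search variable [w] packs the diagram together with its certificate. The first entry
    of [x] is only tested to be a potential embedding, which keeps the relation decidable in [EI];
    the search may thus also succeed outside [AB]. *)
Definition searchq (x w : nat) : Prop :=
  let f := unpairl x in let g0 := unpairl (unpairr x) in let g1 := unpairr (unpairr x) in
  let h0 := unpairl (unpairl w) in let h1 := unpairr (unpairl w) in
  [/\ pembq f, pembq g0 /\ pembq g1, pembq h0 /\ pembq h1,
      unpairl g0 = unpairl g1 & diagq g0 g1 h0 h1 (unpairr w)].

(** * Complexity of the conditions on codes *)

Local Notation E := (EI KK).

Lemma dec_simeqq x s y t : computable_in E x -> computable_in E s ->
  computable_in E y -> computable_in E t ->
  decidable_in E (fun n => simeqq (x n) (s n) (y n) (t n)).
Proof.
move=> cx cs cy ct; apply: dec_comp (dec_oracle _) _.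
exact/(comp_pair cx)/(comp_pair cs)/comp_pair.
Qed.

Lemma dec_memq y s : computable_in E y -> computable_in E s ->
  decidable_in E (fun n => memq (y n) (s n)).
Proof. by move=> *; apply: dec_simeqq. Qed.

Lemma dec_embq x y s : computable_in E x -> computable_in E y -> computable_in E s ->
  decidable_in E (fun n => embq (x n) (y n) (s n)).
Proof. by move=> *; apply: dec_simeqq => //; apply: comp_unpairl. Qed.

Lemma dec_pembq x : computable_in E x -> decidable_in E (fun n => pembq (x n)).
Proof.
by move=> cx; apply: dec_and; apply: dec_memq; try exact: comp_const;
  repeat (apply: comp_unpairl || apply: comp_unpairr).
Qed.

Lemma dec_is_embq x : computable_in E x -> decidable_in E (fun n => is_embq (x n)).
Proof.
by move=> cx; apply: dec_embq; repeat (apply: comp_unpairl || apply: comp_unpairr).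
Qed.

Lemma dec_amalgq x s y t z u v e :
    computable_in E x -> computable_in E s -> computable_in E y -> computable_in E t ->
    computable_in E z -> computable_in E u -> computable_in E v -> computable_in E e ->
  decidable_in E (fun n => amalgq (x n) (s n) (y n) (t n) (z n) (u n) (v n) (e n)).
Proof.
move=> *; apply: (dec_ext (A := fun n => memq (z n) (e n) /\
  simeqq (x n) (catrev_code (unpairl (x n)) (s n)) (z n) (catrev_code (u n) (e n)) /\
  simeqq (y n) (catrev_code (unpairl (y n)) (t n)) (z n) (catrev_code (v n) (e n)))).
  by move=> n; split=> [[? []]|[]].
apply: dec_and; first exact: dec_memq.
by apply: dec_and; apply: dec_simeqq => //; apply: comp_catrev => //; apply: comp_unpairl.
Qed.

Lemma dec_diagq f0 f1 g0 g1 e :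
    computable_in E f0 -> computable_in E f1 -> computable_in E g0 ->
      computable_in E g1 -> computable_in E e ->
  decidable_in E (fun n => diagq (f0 n) (f1 n) (g0 n) (g1 n) (e n)).
Proof.
move=> cf0 cf1 cg0 cg1 ce.
apply: (dec_ext (A := fun n => is_embq (g0 n) /\
  (unpairl (g0 n) = unpairl (unpairr (f0 n)) /\
    unpairl (g1 n) = unpairl (unpairr (f1 n))) /\
  unpairl (unpairr (g0 n)) = unpairl (unpairr (g1 n)) /\
  (is_embq (f0 n) /\ is_embq (f1 n) -> is_embq (g1 n) /\
   amalgq (unpairl (g0 n)) (unpairr (unpairr (f0 n)))
     (unpairl (g1 n)) (unpairr (unpairr (f1 n))) (unpairl (unpairr (g0 n)))
     (unpairr (unpairr (g0 n))) (unpairr (unpairr (g1 n))) (e n)))).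
  by move=> n; split=> [[? [? []]]|[]].
have cl f : computable_in E f ->
  computable_in E (fun n => unpairl (f n)) by apply: comp_unpairl.
have cr f : computable_in E f ->
  computable_in E (fun n => unpairr (f n)) by apply: comp_unpairr.
apply: dec_and; first exact: dec_is_embq.
apply: dec_and; first by apply: dec_and; apply: dec_eq; auto.
apply: dec_and; first by apply: dec_eq; auto.
apply: dec_imp; first by apply: dec_and; apply: dec_is_embq.
by apply: dec_and; [apply: dec_is_embq | apply: dec_amalgq; auto].
Qed.

Lemma dec_searchq : decidable_in E (fun p => searchq (unpairl p) (unpairr p)).
Proof.
pose x := unpairl; pose w := unpairr.
apply: (dec_ext (A := fun p => pembq (unpairl (x p)) /\
  (pembq (unpairl (unpairr (x p))) /\ pembq (unpairr (unpairr (x p)))) /\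
  (pembq (unpairl (unpairl (w p))) /\ pembq (unpairr (unpairl (w p)))) /\
  unpairl (unpairl (unpairr (x p))) = unpairl (unpairr (unpairr (x p))) /\
  diagq (unpairl (unpairr (x p))) (unpairr (unpairr (x p)))
    (unpairl (unpairl (w p))) (unpairr (unpairl (w p))) (unpairr (w p)))).
  by move=> n; split=> [[? [? [? []]]]|[]].
have cl f : computable_in E f ->
  computable_in E (fun n => unpairl (f n)) by apply: comp_unpairl.
have cr f : computable_in E f ->
  computable_in E (fun n => unpairr (f n)) by apply: comp_unpairr.
have cx : computable_in E x by apply/cl/comp_id.
have cw : computable_in E w by apply/cr/comp_id.
apply: dec_and; first by apply: dec_pembq; auto.
apply: dec_and; first by apply: dec_and; apply: dec_pembq; auto.
apply: dec_and; first by apply: dec_and; apply: dec_pembq; auto.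
by apply: dec_and; [apply: dec_eq | apply: dec_diagq]; auto.
Qed.

(** Being a base means that no span lacks a cospan. The existence of a cospan is decided by the
    first jump, and the existence of a bad span by the second. *)
Lemma dec_baseq : decidable_in (jump (jump E)) baseq.
Proof.
(* Each quantifier block of [baseq] is packed into one number: [u] holds the span and [v] the cospan
   with its certificate. *)
pose a u := unpairl u; pose b u := unpairl (unpairr u).
pose c u := unpairl (unpairr (unpairr u)); pose d u := unpairr (unpairr (unpairr u)).
pose span y u := embq y (a u) (b u) /\ embq y (c u) (d u).
pose cospan u v := [/\ embq (a u) (a v) (b v), embq (c u) (a v) (c v) &
  amalgq (a u) (b u) (c u) (d u) (a v) (b v) (c v) (d v)].
have qE x y z w : let q := ⟨x, y, z, w⟩ in
    [/\ a q = x, b q = y, c q = z & d q = w] by rewrite /a /b /c /d !unpairE.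
apply: (dec_ext (A := fun y => ~ exists u, ~ (span y u -> exists v, cospan u v))).
  move=> y; split=> [base z0 s0 z1 s1 E0 E1|base [u []] [E0 E1]].
    apply: NNPP => nv; apply: base.
    exists ⟨z0, s0, z1, s1⟩.
    have [aq bq cq dq] := qE z0 s0 z1 s1.
    rewrite /span /cospan aq bq cq dq => base.
    by have [//|v vP] := base; apply: nv; exists (a v), (b v), (c v), (d v).
  have [l [t0 [t1 [e vP]]]] := base _ _ _ _ E0 E1.
  exists ⟨l, t0, t1, e⟩.
  by have [aq bq cq dq] := qE l t0 t1 e; rewrite /cospan aq bq cq dq.
have cl S f : computable_in S f ->
  computable_in S (fun n => unpairl (f n)) by apply: comp_unpairl.
have cr S f : computable_in S f ->
  computable_in S (fun n => unpairr (f n)) by apply: comp_unpairr.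
have ci := comp_id.
apply: dec_not; apply: dec_jump_ex; apply: dec_not; apply: dec_imp.
  apply: dec_jump; apply: dec_and; apply: dec_embq; rewrite /a /b /c /d; auto 10.
apply: (dec_comp (A := fun u => exists v, cospan u v) _ (cr _ _ (ci _))).
apply: dec_jump_ex.
apply: (dec_ext (A := fun p => let u := unpairl p in let v := unpairr p in
  embq (a u) (a v) (b v) /\ embq (c u) (a v) (c v) /\
  amalgq (a u) (b u) (c u) (d u) (a v) (b v) (c v) (d v))).
  by move=> p; split=> [[? []]|[]].
apply: dec_and; first by apply: dec_embq; rewrite /a /b /c /d; auto 10.
by apply: dec_and; [apply: dec_embq | apply: dec_amalgq]; rewrite /a /b /c /d; auto 10.
Qed.

Lemma dec_double_jump (S A : nat -> Prop) : decidable_in S A ->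
  decidable_in (jump (jump S)) A.
Proof. by move=> dA; apply/dec_jump/dec_jump. Qed.

Lemma dec_AB : decidable_in (jump (jump E)) (pemb_codes (AB (KK := KK))).
Proof.
apply: (dec_ext (A := fun n => pembq n /\ is_embq n /\ baseq (unpairl (unpairr n)))).
  by move=> n; rewrite pemb_codes_AB; split=> [[? []]|[]].
have ci := comp_id.
apply: dec_and; first by apply/dec_double_jump/dec_pembq.
apply: dec_and; first by apply/dec_double_jump/dec_is_embq.
by apply: dec_comp dec_baseq _; apply/comp_unpairl/comp_unpairr.
Qed.

Lemma cCAP_in_jump2 : CAP K -> cCAP_in KK (jump (jump E)).
Proof.
move=> cap; have [s sP] := dec_search (dec_double_jump dec_searchq).
have {}sP x w : eval (jump (jump E)) s x w <->
    searchq x w /\ forall m, m < w -> ~ searchq x m.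
  rewrite sP !unpairE; split=> -[xw min]; split=> // m /min; by rewrite !unpairE.
(* [f] is defined from the search program, so that its graph and its domain
   are those of the program. *)
pose find x y := eval (jump (jump E)) (CComp CLeft s) x y.
pose xcode (t : pemb KK * pemb KK * pemb KK) :=
  pair_code (pemb_code t.1.1) (pair_code (pemb_code t.1.2) (pemb_code t.2)).
pose found t (HH : pemb KK * pemb KK) :=
  find (xcode t) (pair_code (pemb_code HH.1) (pemb_code HH.2)).
pose f t := if excluded_middle_informative (exists HH, found t HH) is left ex
  then Some (sval (constructive_indefinite_description _ ex)) else None.
(* The chosen pair is not claimed to be [HH] itself; its codes, however, are fixed as the output of
   the program. *)
have fP t HH : found t HH -> exists2 HH', f t = Some HH' & found t HH'.
  move=> tHH; rewrite /f; case: excluded_middle_informative => [ex|[]]; last by exists HH.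
  by case: constructive_indefinite_description => HH' /= tHH'; exists HH'.
have fS t HH : f t = Some HH -> found t HH.
  rewrite /f; case: excluded_middle_informative => // ex [<-].
  by case: constructive_indefinite_description.
exists (AB (KK := KK)), f; split.
- split; [exact: AB_distinguished | by move=> F [] | move=> F G0 G1 [Fe Fb] dd dF].
  have [|H0 [H1 [e eP]]] := diagq_ex dd; first by rewrite dF; apply/baseqE.
  (* This solution only guarantees that the search stops; the least one [w] may give a different
     diagram. *)
  pose w0 := pair_code (pair_code (pemb_code H0) (pemb_code H1)) e.
  have pembqP G : pembq (@pemb_code _ _ KK G) by apply/pembqE; exists G.
  have Qw0 : searchq (xcode (F, G0, G1)) w0.
    rewrite /searchq /xcode /w0 /= !unpairE; split=> //.
    by rewrite dd.
  have [w wP] : exists w, searchq (xcode (F, G0, G1)) w /\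
      forall m, m < w -> ~ searchq (xcode (F, G0, G1)) m.
    have [|w] :=
      (search_total (fun p => searchq (unpairl p) (unpairr p)) (xcode (F, G0, G1))).2.
      by exists w0; rewrite !unpairE.
    by rewrite !unpairE => -[Qw min]; exists w; split=> // m /min; rewrite !unpairE.
  have := wP.1; rewrite {1}/searchq /xcode /= !unpairE => -[_ _ [/pembqE [H0' E0]
    /pembqE [H1' E1]] _ _].
  have [|[K0 K1] fE Kf] := fP (F, G0, G1) (H0', H1').
    by exists w; [apply/sP | rewrite /= -E0 -E1 pair_codeK].
  exists K0, K1; split=> //; apply/diagqE => //.
  have [w' /sP [] + _ /= wE] := Kf.
  rewrite /searchq /xcode /= -wE !unpairE => -[_ _ _ _ diag].
  by exists (unpairr w').
- exact: dec_ce_in dec_AB.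
exists (CComp CLeft s) => x y; split=> [fxy|[F [G0 [G1 [H0 [H1 [fE -> ->]]]]]]];
  last first.
  exact: (fS (F, G0, G1) (H0, H1)).
have [w /sP [[/pembqE [F FE] [/pembqE [G0 G0E] /pembqE [G1 G1E]]
  [/pembqE [H0 H0E] /pembqE [H1 H1E]] _ _] _] /= yE] := fxy.
have xE : x = xcode (F, G0, G1) by rewrite /xcode /= -FE -G0E -G1E !pair_codeK.
have [|[K0 K1] fE Kf] := fP (F, G0, G1) (H0, H1).
  by rewrite /found /= -xE -H0E -H1E pair_codeK -yE.
exists F, G0, G1, K0, K1; split=> //.
(* Both [y] and the code of the chosen pair are outputs of the same program on [x]. *)
by apply: eval_fun fxy _; rewrite xE.
Qed.

End Age.

Theorem theorem5p36 (L : language) (K : structure L -> Prop) (hK : age K)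
    (KK : computable_age K) :
  turing_le (pemb_codes (AB (KK := KK))) (jump (jump (EI KK))) /\
  (CAP K -> cCAP_in KK (jump (jump (EI KK)))).
Proof. by split; [apply/dec_turing_le/dec_AB | apply: cCAP_in_jump2]. Qed.
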